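(* Suppose we order the eigenspaces of the hypercube graph $Q_d$, for $d\ge3$, so that $\Lambda_2$ (the eigenspace of eigenvalue $1-\frac4d$) is last. Then there are $4\binom d3$ minimum cardinality extremal designs of $Q_d$, each consisting of $2^{d-2}$ vertices.
   Context: $Q_d$ is the edge graph of the $d$-dimensional hypercube: its vertex set is $\{0,1\}^d$, and two vertices are adjacent iff they differ in exactly one coordinate; it is $d$-regular. Its eigenvalues and eigenspaces are those of the normalized adjacency matrix $\frac1dA$, where $A$ is the adjacency matrix: for $i=0,\dots,d$ the eigenvalue $1-2i/d$ has eigenspace $\Lambda_i$ with basis $\{\phi_x : x\in\{0,1\}^d,\ |x|=i\}$, where $\phi_x(y)=(-1)^{x^\top y}$ for $y\in\{0,1\}^d$ and $|x|$ is the number of ones in $x$. Thus there are $d+1$ eigenspaces. In any ordering of them, $\Lambda_0=\operatorname{span}\{\mathbb{1}\}$ (the span of the all-ones vector) is placed first. A vertex subset $W\subseteq\{0,1\}^d$ averages an eigenspace $\Lambda$ with real weights $(a_w)_{w\in W}$ if $\sum_{w\in W}a_w\phi(w)=\frac1{2^d}\sum_{y\in\{0,1\}^d}\phi(y)$ for every $\phi$ in a basis of $\Lambda$. For a graph with $m$ eigenspaces in a fixed order, a $k$-graphical design is a vertex subset $W$ for which there are weights $a_w\in\mathbb{R}$ with which $W$ averages the first $k$ eigenspaces, and an extremal design is an $(m-1)$-graphical design, i.e. one that averages all eigenspaces except the last; no sign condition is imposed on the weights. Here $m=d+1$. The cardinality of a design is the number of vertices in $W$, and designs are counted as vertex subsets.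 *)

(* Defs.v *)
From mathcomp Require Import all_boot all_order all_fingroup all_algebra.
From mathcomp Require Import boolp reals.

Set Implicit Arguments.
Unset Strict Implicit.
Unset Printing Implicit Defensive.

Import GRing.Theory.
Local Open Scope ring_scope.

(* A real function phi on the vertex set V is a row vector in 'rV[R]_#|V|, its
   value at v : V being phi 0 (enum_rank v); a space of functions is the row
   space of a matrix with #|V| columns. *)

Definition adjacency_mx (R : realType) (V : finType) (adj : rel V) :
    'M[R]_#|V| :=
  \matrix_(i, j) (adj (enum_val i) (enum_val j))%:R.

Definition hypercube (d : nat) : finType := {ffun 'I_d -> bool}.

Definition hypercube_adj (d : nat) : rel (hypercube d) :=
  fun x y => #|[set i | x i != y i]| == 1%N.

Definition hypercube_norm_adjacency (R : realType) (d : nat) :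
    'M[R]_#|hypercube d| :=
  d%:R^-1 *: adjacency_mx R (@hypercube_adj d).

(* Mathcomp's eigenspace consists of left eigenvectors, which makes no
   difference here as the matrix is symmetric. *)
Definition hypercube_eigenspace (R : realType) (d : nat) (i : 'I_d.+1) :
    'M[R]_#|hypercube d| :=
  eigenspace (hypercube_norm_adjacency R d) (1 - (2 * i)%N%:R / d%:R).

Definition averages (R : realType) (V : finType) (W : {set V}) (a : V -> R)
    (L : 'M[R]_#|V|) : Prop :=
  exists k (B : 'M[R]_(k, #|V|)),
    [/\ row_free B, (B :=: L)%MS &
        forall r : 'I_k,
          \sum_(w in W) a w * B r (enum_rank w)
            = #|V|%:R^-1 * \sum_(y : V) B r (enum_rank y)].

(* Lam 0, ..., Lam (m - 1) are the eigenspaces of the graph, in order; only the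
   values of the weights a on W matter. *)
Definition graphical_design (R : realType) (V : finType) (m : nat)
    (Lam : 'I_m -> 'M[R]_#|V|) (k : nat) (W : {set V}) : Prop :=
  exists a : V -> R, forall j : 'I_m, (j < k)%N -> averages W a (Lam j).

Definition extremal_design (R : realType) (V : finType) (m : nat)
    (Lam : 'I_m -> 'M[R]_#|V|) (W : {set V}) : Prop :=
  graphical_design Lam m.-1 W.

Definition min_extremal_design (R : realType) (V : finType) (m : nat)
    (Lam : 'I_m -> 'M[R]_#|V|) (W : {set V}) : Prop :=
  extremal_design Lam W /\
  forall W' : {set V}, extremal_design Lam W' -> (#|W| <= #|W'|)%N.

Definition min_extremal_designs (R : realType) (V : finType) (m : nat)
    (Lam : 'I_m -> 'M[R]_#|V|) : {set {set V}} :=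
  [set W | `[< min_extremal_design Lam W >]].

(* The eigenspaces of the hypercube, with hypercube_eigenspace (s j) in
   position j. *)
Definition ordered_eigenspaces (R : realType) (d : nat) (s : 'S_d.+1)
    (j : 'I_d.+1) : 'M[R]_#|hypercube d| :=
  hypercube_eigenspace R (s j).

(* Main.v *)
Require Import Defs.
From mathcomp Require Import all_boot all_order all_fingroup all_algebra.
From mathcomp Require Import boolp reals.
From mathcomp Require Import ring lra zify.

Set Implicit Arguments.
Unset Strict Implicit.
Unset Printing Implicit Defensive.

Import Order.TTheory GRing.Theory Num.Theory.
Local Open Scope ring_scope.

(** Up to the factor 2^d, the weights of an extremal design W form a function f
    supported in W.  By Fourier inversion, averaging every eigenspace except
    Lambda_2 means that f = 1 + sum_(|x| = 2) c_x chi_x, where the character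
    chi_x is the function phi_x of the eigenbasis, x being read as a subset of
    the coordinates.  So the question is how small the support of such a
    quadratic function can be.

    Let c_x be nonzero, with x = {i, j}.  The second difference of f over a
    2-dimensional face in the directions i and j is 4 c_x chi_x, which never
    vanishes; hence each of the 2^(d-2) faces parallel to it meets W, so that
    4 |W| >= 2^d.  (If every c_x is 0, then f = 1 and W is the whole cube.)

    In the case of equality each such face contains exactly one point of W, so
    f = 4 c_x chi_x on W for every x in the set E of pairs with nonzero c_x.
    Summing over E, f = 1 + |E| f / 4 on W: f is constant on W, and as its total
    mass is 2^d and 4 |W| = 2^d, the constant is 4.  Hence |E| = 3 and
    c_x chi_x = 1 on W for x in E ([quadratic_eq4], [card_quadratic_pairs],
    [coef_chi_eq1]).  Moving from a point of W along a coordinate i changes f by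
    -2 times the degree of i in the graph E, while f only takes the values 0 and
    4; all degrees are then 0 or 2, and a graph with three edges and such
    degrees is a triangle T ([quadratic_degree], [exists_triangle]).  Therefore
    W consists of the points that, on the three coordinates of T, agree with a
    fixed point or with its complement ([quadratic_support_triangle]).

    Conversely every such set is a design, since four times its indicator
    function is 1 plus three signed characters of weight 2
    ([indicator_triangle]), and these characters are orthogonal to all
    eigenspaces other than Lambda_2.  Exactly one of two complementary patterns
    on T has at most one 1, so the minimum designs are indexed by a triple T and
    a subset of T with at most one element: 4 choices for each T. *)

(** * Hypercube neighbours and characters *)

Definition flip (d : nat) (i : 'I_d) (y : hypercube d) : hypercube d :=
  [ffun k => y k (+) (k == i)].

Lemma flipK d (i : 'I_d) : involutive (flip i).
Proof. by move=> y; apply/ffunP=> k; rewrite !ffunE -addbA addbb addbF. Qed.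

Lemma flip_inj d (i : 'I_d) : injective (flip i).
Proof. exact: can_inj (flipK i). Qed.

Lemma hypercube_adjP d (z y : hypercube d) :
  reflect (exists i, z = flip i y) (hypercube_adj z y).
Proof.
apply: (iffP cards1P) => [[i] zy|[i ->]]; exists i.
  apply/ffunP=> k; have /setP/(_ k) := zy; rewrite !inE ffunE => <-.
  by case: (z k); case: (y k).
by apply/setP=> k; rewrite !inE ffunE; case: (y k); case: (k == i).
Qed.

Lemma hypercube_adj_sym d : symmetric (@hypercube_adj d).
Proof.
move=> z y; rewrite /hypercube_adj; congr (#|pred_of_set _| == _).
by apply/setP=> k; rewrite !inE eq_sym.
Qed.

Lemma sum_neighbors (R : realFieldType) d (F : hypercube d -> R)
    (y : hypercube d) :
  \sum_(z | hypercube_adj z y) F z = \sum_i F (flip i y).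
Proof.
rewrite (eq_bigl [in [set flip i y | i : 'I_d]]) => [|z].
  rewrite big_imset //= => i j _ _ /ffunP/(_ i).
  by rewrite !ffunE eqxx => /addbI; case: eqP.
by apply/hypercube_adjP/imsetP => [[i ->]|[i _ ->]]; exists i.
Qed.

(** The Fourier character of weight #|x|, with the 0-1 vector x replaced by the
    set of its ones. *)
Definition chi (R : realFieldType) (d : nat) (x : {set 'I_d})
    (y : hypercube d) : R :=
  \prod_(i in x) (-1) ^+ y i.

Lemma chi0 (R : realFieldType) d (y : hypercube d) : chi R set0 y = 1.
Proof. by rewrite /chi big_set0. Qed.

Lemma chi2 (R : realFieldType) d (i j : 'I_d) (y : hypercube d) :
  i != j -> chi R [set i; j] y = (-1) ^+ y i * (-1) ^+ y j.
Proof. by move=> ij; rewrite /chi big_setU1 ?big_set1 ?inE. Qed.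

Lemma chi_sq (R : realFieldType) d (x : {set 'I_d}) (y : hypercube d) :
  chi R x y * chi R x y = 1.
Proof.
by rewrite /chi -big_split big1 //= => i _; rewrite -expr2 sqrr_sign.
Qed.

Lemma chi_neq0 (R : realFieldType) d (x : {set 'I_d}) (y : hypercube d) :
  chi R x y != 0.
Proof.
by apply: contra_eq_neq (chi_sq R x y) => ->; rewrite mul0r eq_sym oner_eq0.
Qed.

Lemma chi_flip (R : realFieldType) d (x : {set 'I_d}) (i : 'I_d)
    (y : hypercube d) :
  chi R x (flip i y) = (-1) ^+ (i \in x) * chi R x y.
Proof.
have -> : (-1) ^+ (i \in x) = \prod_(k in x) (-1) ^+ (k == i) :> R.
  have [ix|ix] := boolP (i \in x).
    rewrite (bigD1 i) //= eqxx big1 ?mulr1 // => k /andP[_ /negbTE ->].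
    by rewrite expr0.
  rewrite big1 // => k kx; case: eqP => // ki; by rewrite -ki kx in ix.
rewrite /chi -big_split; apply: eq_bigr => k _.
by rewrite ffunE signr_addb mulrC.
Qed.

(** Flipping a coordinate of x is an involution of the cube that changes the
    sign of the character. *)
Lemma sum_chi (R : realFieldType) d (x : {set 'I_d}) :
  x != set0 -> \sum_y chi R x y = 0.
Proof.
case/set0Pn=> i ix; suff : \sum_y chi R x y = - \sum_y chi R x y by lra.
rewrite {1}(reindex_inj (@flip_inj d i)) -sumrN; apply: eq_bigr => y _.
by rewrite chi_flip ix expr1 mulN1r.
Qed.

(** The left-hand side expands the product over i of 1 + (-1)^(y_i + z_i), in
    which a coordinate where y and z differ contributes a factor 0. *)
Lemma sum_chi_chi (R : realFieldType) d (y z : hypercube d) :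
  \sum_x chi R x y * chi R x z = (if y == z then 2 ^+ d else 0).
Proof.
have -> : \sum_x chi R x y * chi R x z =
    \prod_i ((-1) ^+ (y i (+) z i) + 1 : R).
  rewrite bigA_distr; apply: eq_bigr => x _.
  rewrite /chi -big_split -big_mkcond /=.
  by apply: eq_bigr => i _; rewrite signr_addb.
have [->|] := eqVneq y z.
  rewrite (eq_bigr (fun=> 2)) ?prodr_const ?card_ord // => i _.
  by rewrite addbb.
move=> /eqP yz; have [i yzi] : exists i, y i != z i.
  apply/existsP; apply: contra_notT yz; rewrite negb_exists => /forallP yz.
  by apply/ffunP=> i; apply/eqP; rewrite -[_ == _]negbK.
rewrite (bigD1 i) //= (addbC (y i)); move: yzi.
by case: (y i); case: (z i) => //= _; rewrite expr1 addNr mul0r.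
Qed.

Lemma fourier_inversion (R : realFieldType) d (f : hypercube d -> R)
    (y : hypercube d) :
  2 ^+ d * f y = \sum_x (\sum_z f z * chi R x z) * chi R x y.
Proof.
under eq_bigr do rewrite mulr_suml.
rewrite exchange_big /= (bigD1 y) //= [X in _ + X]big1 ?addr0 => [|z zy].
  under eq_bigr do rewrite -mulrA.
  by rewrite -mulr_sumr sum_chi_chi eqxx mulrC.
under eq_bigr do rewrite -mulrA.
by rewrite -mulr_sumr sum_chi_chi (negbTE zy) mulr0.
Qed.

(** Taking differences in the directions i and j kills every character that
    does not contain both, so only the coefficient of {i, j} is left: a nonzero
    coefficient forces f to be nonzero somewhere on each face in these
    directions. *)
Lemma second_difference (R : realFieldType) d (f : hypercube d -> R)
    (c : {set 'I_d} -> R) (i j : 'I_d) (y : hypercube d) :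
  (forall z, f z = 1 + \sum_(x : {set 'I_d} | #|x| == 2%N) c x * chi R x z) ->
  i != j ->
  f y - f (flip i y) - f (flip j y) + f (flip i (flip j y))
    = 4 * (c [set i; j] * chi R [set i; j] y).
Proof.
move=> fE ij.
have -> : f y - f (flip i y) - f (flip j y) + f (flip i (flip j y)) =
  \sum_(x : {set 'I_d} | #|x| == 2%N)
    (1 - (-1) ^+ (i \in x)) * (1 - (-1) ^+ (j \in x)) * (c x * chi R x y).
  transitivity (\sum_(x : {set 'I_d} | #|x| == 2%N)
   (c x * chi R x y - c x * chi R x (flip i y)
    - c x * chi R x (flip j y) + c x * chi R x (flip i (flip j y)))).
    by rewrite !(big_split, sumrN) /= !fE; ring.
  by apply: eq_bigr => x _; rewrite !chi_flip; ring.
rewrite (bigD1 [set i; j]) ?cards2 ?ij //= !inE !eqxx orbT big1 /=.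
  by rewrite expr1; ring.
move=> x /andP[/eqP x2 xij]; have : ~~ ((i \in x) && (j \in x)).
  apply: contra xij => /andP[ix jx]; rewrite eq_sym eqEcard x2 cards2 ij andbT.
  by apply/subsetP=> k; rewrite !inE => /orP[] /eqP ->.
case: (i \in x); case: (j \in x) => //= _;
  by rewrite expr0 subrr ?mul0r ?mulr0 ?mul0r.
Qed.

(** * Quadratic functions with small support *)

Lemma card_hypercube d : #|hypercube d| = (2 ^ d)%N.
Proof. by rewrite card_ffun card_bool card_ord. Qed.

Lemma sum_mem_inj (V : finType) (W : {set V}) (h : V -> V) :
  injective h -> (\sum_y (h y \in W) = #|W|)%N.
Proof.
move=> inj; rewrite -sum1_card [RHS]big_mkcond [RHS](reindex_inj inj) /=.
by apply: eq_bigr => y _; case: (h y \in W).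
Qed.

(** Counts the points of W on the face through y in the directions i and j; the
    sum over all y then sees each face four times, which avoids choosing a
    representative of each face. *)
Definition face_count d (W : {set hypercube d}) (i j : 'I_d)
    (y : hypercube d) : nat :=
  ((y \in W) + (flip i y \in W) + (flip j y \in W)
    + (flip i (flip j y) \in W))%N.

Lemma sum_face_count d (W : {set hypercube d}) (i j : 'I_d) :
  (\sum_y face_count W i j y = 4 * #|W|)%N.
Proof.
have inj := @flip_inj d; rewrite !big_split /= (@sum_mem_inj _ _ id) //.
rewrite (sum_mem_inj _ (inj i)) (sum_mem_inj _ (inj j)).
rewrite (sum_mem_inj _ (inj_comp (inj i) (inj j))).
by rewrite !mulSn mul0n addn0 !addnA.
Qed.

(** The bit b makes the set closed under complementation, so that A and T minus A
    define the same design. *)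
Definition triangle_design (d : nat) (T A : {set 'I_d}) : {set hypercube d} :=
  [set y : hypercube d | [exists b, forall i in T, y i == (i \in A) (+) b]].

Section Support.
Variables (R : realFieldType) (d : nat).
Variables (f : hypercube d -> R) (c : {set 'I_d} -> R) (W : {set hypercube d}).
Hypothesis fE : forall y,
  f y = 1 + \sum_(x : {set 'I_d} | #|x| == 2%N) c x * chi R x y.
Hypothesis supp_f : forall y, f y != 0 -> y \in W.
Hypothesis cardW : (4 * #|W| <= 2 ^ d)%N.

(* The edges of a graph on the coordinates, which turns out to be a triangle. *)
Let E := [set x : {set 'I_d} | (#|x| == 2%N) && (c x != 0)].

Lemma quadratic_sum_pairs y : f y = 1 + \sum_(x in E) c x * chi R x y.
Proof.
rewrite fE; congr (_ + _); rewrite big_mkcond [RHS]big_mkcond /=.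
apply: eq_bigr => x _.
by rewrite inE; case: (_ == _) => //=; case: eqVneq => // ->; rewrite mul0r.
Qed.

Lemma quadratic_eq0 z : z \notin W -> f z = 0.
Proof. by move=> zW; apply: contraNeq zW; exact: supp_f. Qed.

Lemma face_count_gt0 i j y :
  i != j -> c [set i; j] != 0 -> (0 < face_count W i j y)%N.
Proof.
move=> ij cij; rewrite lt0n; apply/negP => /eqP N0.
have := second_difference y fE ij; rewrite /face_count in N0.
rewrite !quadratic_eq0; try by (apply/negP => H; move: N0; rewrite H; lia).
rewrite !subr0 addr0 => /esym/eqP; rewrite !mulf_eq0 (negbTE cij).
by rewrite (negbTE (chi_neq0 _ _ _)) pnatr_eq0.
Qed.

(** The counts are at least 1 and their sum 4 |W| is at most the number 2^d of
    vertices. *)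
Lemma face_count1 i j y :
  i != j -> c [set i; j] != 0 -> face_count W i j y = 1%N.
Proof.
move=> ij cij.
have := leqif_sum (fun z (_ : true) => leqif_eq (@face_count_gt0 i j z ij cij)).
rewrite sum_face_count sum1_card card_hypercube => -[le eqle].
have /esym := eqle; rewrite eqn_leq le cardW => /forallP/(_ y) /=.
by rewrite eq_sym => /eqP.
Qed.

(** A point of W is alone on its face, so the second difference there is the
    value of f at that point. *)
Lemma quadratic_on_support x y :
  x \in E -> y \in W -> f y = 4 * (c x * chi R x y).
Proof.
rewrite inE => /andP[/cards2P[i [j [ij ->]]] cij] yW.
have := face_count1 y ij cij; rewrite /face_count yW => N1.
rewrite -(second_difference y fE ij).
rewrite [f (flip i y)]quadratic_eq0 1?[f (flip j y)]quadratic_eq0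
  1?[f (flip i (flip j y))]quadratic_eq0;
  try by (apply/negP => H; move: N1; rewrite H; lia).
by rewrite !subr0 addr0.
Qed.

Lemma sum_quadratic : \sum_y f y = 2 ^+ d.
Proof.
under eq_bigr do rewrite fE.
rewrite big_split /= sumr_const card_hypercube natrX exchange_big /=.
rewrite big1 ?addr0 // => x x2.
by rewrite -mulr_sumr sum_chi ?mulr0 // -card_gt0 (eqP x2).
Qed.

Lemma quadratic_pairs_neq0 : exists x, x \in E.
Proof.
apply/set0Pn; apply: contraTneq cardW => E0; rewrite -ltnNge.
have -> : W = setT.
  apply/setP=> y; rewrite inE supp_f // quadratic_sum_pairs E0.
  by rewrite big_set0 addr0 oner_eq0.
by rewrite cardsT card_hypercube; have := expn_gt0 2 d; lia.
Qed.

Lemma card_quadratic_support : (4 * #|W| = 2 ^ d)%N.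
Proof.
have [x] := quadratic_pairs_neq0.
rewrite inE => /andP[/cards2P[i [j [ij ->]]] cij].
rewrite -(sum_face_count W i j) -card_hypercube -sum1_card.
by apply: eq_bigr => y _; apply: face_count1.
Qed.

(** On W the expansion of f becomes f = 1 + |E| f / 4, which has at most one
    solution; the total mass 2^d = 4 |W| of f then gives its value. *)
Lemma quadratic_eq4 y : y \in W -> f y = 4.
Proof.
have fW z : z \in W -> (4 - #|E|%:R) * f z = 4.
  move=> zW; have := quadratic_sum_pairs z.
  have -> : \sum_(x in E) c x * chi R x z = #|E|%:R * (f z / 4).
    rewrite mulr_natl -sumr_const; apply: eq_bigr => x xE.
    by rewrite (quadratic_on_support xE zW); field.
  by lra.
move=> yW; have : #|W|%:R * f y = #|W|%:R * 4.
  rewrite mulr_natl -sumr_const (eq_bigr f) => [|z zW].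
    rewrite mulrC -natrM card_quadratic_support natrX -sum_quadratic.
    rewrite [RHS](bigID (fun z => z \in W)) /=.
    by rewrite [X in _ + X]big1 ?addr0 // => z; exact: quadratic_eq0.
  have := fW z zW; have := fW y yW.
  have [->|E4] := eqVneq (4 - #|E|%:R : R) 0; first by lra.
  by move=> fy fz; apply: (mulfI E4); rewrite fy fz.
apply: mulfI; rewrite pnatr_eq0 -lt0n; apply/card_gt0P; by exists y.
Qed.

Lemma quadratic_support_neq0 : exists w, w \in W.
Proof.
apply/set0Pn; rewrite -card_gt0; have := expn_gt0 2 d.
by have := card_quadratic_support; lia.
Qed.

Lemma card_quadratic_pairs : #|E| = 3%N.
Proof.
have [w wW] := quadratic_support_neq0; have := quadratic_sum_pairs w.
have -> : \sum_(x in E) c x * chi R x w = #|E|%:R.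
  rewrite -sumr_const; apply: eq_bigr => x xE.
  by have := quadratic_on_support xE wW; rewrite quadratic_eq4 //; lra.
rewrite quadratic_eq4 // => H; apply/eqP; rewrite -(eqr_nat R); apply/eqP; lra.
Qed.

Lemma coef_chi_eq1 x y : x \in E -> y \in W -> c x * chi R x y = 1.
Proof.
move=> xE yW; have := quadratic_on_support xE yW.
by rewrite quadratic_eq4 //; lra.
Qed.

(** The coefficient c_x is the sign chi_x(w) at any point w of W; when all the
    signs match at y, f(y) = 1 + |E| is nonzero. *)
Lemma mem_quadratic_support w y : w \in W ->
  (y \in W) = [forall x in E, chi R x y * chi R x w == 1].
Proof.
move=> wW; apply/idP/forall_inP => [yW x xE|H].
  have cE : c x = chi R x w.
    by rewrite -[c x]mulr1 -(chi_sq R x w) mulrA (coef_chi_eq1 xE wW) mul1r.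
  by rewrite -cE mulrC (coef_chi_eq1 xE yW).
apply: supp_f; rewrite quadratic_sum_pairs.
suff -> : \sum_(x in E) c x * chi R x y = #|E|%:R.
  by rewrite card_quadratic_pairs; apply/eqP => ?; lra.
rewrite -sumr_const; apply: eq_bigr => x xE.
have := coef_chi_eq1 xE wW; have /eqP := H x xE => H1 H2.
by rewrite -[LHS]mulr1 -[X in _ * X = _](chi_sq R x w) mulrACA H2 H1 mulr1.
Qed.

(** A step along the coordinate i from a point of W takes f from 4 to
    4 - 2 deg i, which has to be 0 or 4. *)
Lemma quadratic_degree i : (\sum_(x in E) (i \in x : nat))%N \in [:: 0; 2]%N.
Proof.
have [w wW] := quadratic_support_neq0.
have fw : f (flip i w) = 4 - 2 * (\sum_(x in E) (i \in x : nat))%N%:R.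
  rewrite quadratic_sum_pairs.
  rewrite (eq_bigr (fun x : {set 'I_d} => 1 - 2 * (i \in x)%:R)) => [|x xE].
    rewrite big_split /= sumr_const card_quadratic_pairs sumrN -mulr_sumr.
    by rewrite natr_sum; ring.
  rewrite chi_flip mulrCA (coef_chi_eq1 xE wW) mulr1.
  by case: (i \in x) => /=; ring.
have [fW|fW] := boolP (flip i w \in W).
  have D0 : (\sum_(x in E) (i \in x : nat))%N%:R = 0 :> R.
    by have := quadratic_eq4 fW; lra.
  by move/eqP: D0; rewrite pnatr_eq0 => /eqP ->.
have D2 : (\sum_(x in E) (i \in x : nat))%N%:R = 2 :> R.
  have : f (flip i w) = 0 by exact: quadratic_eq0.
  lra.
by move/eqP: D2; rewrite eqr_nat => /eqP ->.
Qed.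

(** The degrees sum to 6 and are 0 or 2, so exactly three coordinates have
    positive degree, and E consists of all the pairs among them. *)
Lemma exists_triangle : exists2 T : {set 'I_d}, #|T| = 3%N &
  E = [set x : {set 'I_d} | x \subset T & #|x| == 2%N].
Proof.
pose T := [set i | \sum_(x in E) (i \in x : nat) != 0%N]%N.
have cardT3 : #|T| = 3%N.
  (* Handshake: the three pairs have total size 6. *)
  suff : (\sum_(i in T) 2 = 6)%N by rewrite sum_nat_const; lia.
  transitivity (\sum_i \sum_(x in E) (i \in x : nat))%N.
    rewrite big_mkcond; apply: eq_bigr => i _; rewrite inE.
    by have := quadratic_degree i; rewrite !inE => /orP[] /eqP ->.
  rewrite exchange_big /= (eq_bigr (fun=> 2%N)) => [|x].
    by rewrite sum_nat_const card_quadratic_pairs.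
  rewrite inE => /andP[/eqP x2 _]; rewrite -[RHS]x2 -sum1_card [RHS]big_mkcond.
  by apply: eq_bigr => i _; case: (i \in x).
exists T => //; apply/eqP.
rewrite eqEcard cards_draws cardT3 card_quadratic_pairs andbT.
apply/subsetP=> x xE; rewrite inE; move: (xE); rewrite inE => /andP[-> _].
rewrite andbT.
by apply/subsetP=> i ix; rewrite inE (bigD1 x) //= ix.
Qed.

Lemma quadratic_support_triangle : exists T A : {set 'I_d},
  [/\ #|T| = 3, A \subset T, #|A| <= 1 & W = triangle_design T A]%N.
Proof.
have [w wW] := quadratic_support_neq0; have [T cardT ET] := exists_triangle.
(* Either the pattern of w on T or its complement has at most one element. *)
pose A0 := [set i in T | w i].
have A0T : A0 \subset T by apply/subsetP=> i; rewrite inE => /andP[].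
have WE y : (y \in W) =
    [forall i in T, forall k in T, y i (+) w i == y k (+) w k].
  rewrite (mem_quadratic_support _ wW) ET; apply/forall_inP/forall_inP => H.
    move=> i iT; apply/forall_inP => k kT; have [->//|ik] := eqVneq i k.
    have /H : [set i; k] \in [set x : {set 'I_d} | x \subset T & #|x| == 2%N].
      rewrite inE cards2 ik andbT.
      by apply/subsetP=> l; rewrite !inE => /orP[] /eqP ->.
    rewrite !chi2 // mulrACA -!signr_addb.
    move/eqP; rewrite -[RHS]/((-1) ^+ false) => /signr_inj.
    by case: (y i (+) w i); case: (y k (+) w k).
  move=> x; rewrite inE => /andP[/subsetP xT /cards2P[i [k [ik xE]]]].
  have iT : i \in T by apply: xT; rewrite xE !inE eqxx.
  have kT : k \in T by apply: xT; rewrite xE !inE eqxx orbT.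
  have /forall_inP/(_ k kT)/eqP yw := H i iT.
  rewrite xE !chi2 // mulrACA -!signr_addb yw.
  by rewrite addbb.
have [A [AT A1 [e Ae]]] : exists A : {set 'I_d},
    [/\ A \subset T, (#|A| <= 1)%N &
        exists e, forall i, i \in T -> (i \in A) = w i (+) e].
  have [A1|A2] := leqP #|A0| 1.
    exists A0; split=> //; by exists false => i iT; rewrite inE iT addbF.
  exists (T :\: A0); split; first exact: subsetDl.
    by have := cardsID A0 T; rewrite (setIidPr A0T); lia.
  by exists true => i iT; rewrite !inE iT andbT addbT.
exists T, A; split=> //; apply/setP=> y; rewrite WE inE.
apply/forall_inP/existsP => [H|[b /forall_inP H] i iT].
  have [t tT] : exists t, t \in T by apply/card_gt0P; rewrite cardT.
  exists (y t (+) w t (+) e); apply/forall_inP=> i iT; rewrite Ae //.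
  have /forall_inP/(_ t tT)/eqP <- := H i iT.
  by case: (y i); case: (w i); case: e {Ae}.
apply/forall_inP=> k kT; have /eqP -> := H i iT; have /eqP -> := H k kT.
by rewrite !Ae //; case: (w i); case: (w k); case: e {Ae}; case: b {H}.
Qed.
End Support.

(** * Counting the triangle designs *)

(** T is recovered as the set of coordinates whose flip does not preserve the
    design.  For a given T, two different patterns of the same design are
    complementary in T, which is impossible if both have at most one element. *)
Lemma triangle_design_inj d (T T' A A' : {set 'I_d}) :
  #|T| = 3%N -> #|T'| = 3%N -> A \subset T -> A' \subset T' ->
  (#|A| <= 1)%N -> (#|A'| <= 1)%N ->
  triangle_design T A = triangle_design T' A' -> (T, A) = (T', A').
Proof.
pose v (A : {set 'I_d}) : hypercube d := [ffun i => i \in A].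
have vA T1 A1 : v A1 \in triangle_design T1 A1.
  rewrite inE; apply/existsP; exists false; apply/forall_inP=> i _.
  by rewrite ffunE addbF.
have TE (T1 A1 : {set 'I_d}) : #|T1| = 3%N ->
    T1 = [set i : 'I_d | [exists y : hypercube d,
      (y \in triangle_design T1 A1) &&
      (flip i y \notin triangle_design T1 A1)]].
  move=> T3; apply/setP=> i; rewrite inE; apply/idP/existsP => [iT|[y /andP[]]].
    exists (v A1); rewrite vA /=; apply/negP; rewrite inE.
    case/existsP=> b /forall_inP H.
    have [k /setD1P[ki kT]] : exists k, k \in T1 :\ i.
      by apply/card_gt0P; have := cardsD1 i T1; rewrite iT; lia.
    have := H i iT; have := H k kT; rewrite !ffunE eqxx (negbTE ki).
    by case: (i \in A1); case: (k \in A1); case: b {H}.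
  rewrite !inE => /existsP[b /forall_inP H]; apply: contraNT => iT.
  apply/existsP; exists b; apply/forall_inP=> k kT; rewrite ffunE.
  have -> : (k == i) = false by apply: contraNF iT => /eqP <-.
  by rewrite addbF H.
move=> T3 T'3 AT A'T A1 A'1 WE.
have TT : T = T' by rewrite (TE T A T3) (TE T' A' T'3) WE.
rewrite -TT in WE A'T *; congr pair.
have := vA T A; rewrite WE inE => /existsP[b /forall_inP H].
case: b H => H; last first.
  apply/setP=> i; have [iT|iT] := boolP (i \in T).
    by have /eqP := H i iT; rewrite ffunE addbF.
  by rewrite (contraNF (subsetP AT i) iT) (contraNF (subsetP A'T i) iT).
suff : T \subset A :|: A'.
  by move=> /subset_leq_card; have := (leq_card_setU A A').1; lia.
apply/subsetP=> i iT; have /eqP := H i iT; rewrite ffunE inE addbT => ->.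
by rewrite orNb.
Qed.

Definition triangle_index (d : nat) : {set {set 'I_d} * {set 'I_d}} :=
  [set p : {set 'I_d} * {set 'I_d} |
    [&& #|p.1| == 3, p.2 \subset p.1 & #|p.2| <= 1]]%N.

Lemma card_triangle_index d : #|triangle_index d| = (4 * 'C(d, 3))%N.
Proof.
rewrite -sum1_card (eq_bigl (fun p : {set 'I_d} * {set 'I_d} =>
  (#|p.1| == 3%N) && ((p.2 \subset p.1) && (#|p.2| <= 1)%N))) => [|p];
  last by rewrite inE.
rewrite -(pair_big_dep (fun T : {set 'I_d} => #|T| == 3%N)
  (fun T A : {set 'I_d} => (A \subset T) && (#|A| <= 1)%N) (fun _ _ => 1%N)) /=.
rewrite (eq_bigr (fun=> 4%N)) => [|T /eqP T3].
  by rewrite sum_nat_const -cardsE card_draws card_ord mulnC.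
rewrite sum1dep_card.
have -> : [set A : {set 'I_d} | (A \subset T) && (#|A| <= 1)%N] =
    [set A : {set 'I_d} | A \subset T & #|A| == 0%N] :|:
    [set A : {set 'I_d} | A \subset T & #|A| == 1%N].
  by apply/setP=> A; rewrite !inE -andb_orr; case: #|A| => [|[|n]].
rewrite cardsU !cards_draws T3.
rewrite [X in (_ - #|pred_of_set X|)%N](_ : _ = set0) ?cards0 //.
by apply/setP=> A; rewrite !inE; case: #|A| => [|n]; rewrite ?andbF.
Qed.

(** * Averaging and eigenspaces *)

(** Pairing a function with this vector gives its weighted sum over W minus its
    mean. *)
Definition discrepancy (R : realType) (V : finType) (W : {set V}) (a : V -> R) :
    'cV[R]_#|V| :=
  \col_i ((if enum_val i \in W then a (enum_val i) else 0) - #|V|%:R^-1).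

Lemma mulmx_discrepancy (R : realType) (V : finType) (W : {set V}) (a : V -> R)
    m (B : 'M[R]_(m, #|V|)) (r : 'I_m) :
  (B *m discrepancy W a) r 0 =
    \sum_(w in W) a w * B r (enum_rank w)
      - #|V|%:R^-1 * \sum_(y : V) B r (enum_rank y).
Proof.
rewrite mxE (reindex enum_rank) /=; last first.
  by exists enum_val => i _; rewrite ?enum_rankK ?enum_valK.
rewrite mulr_sumr [X in X - _]big_mkcond /= -sumrB; apply: eq_bigr => y _.
by rewrite mxE enum_rankK; case: ifP => _; ring.
Qed.

(** Averaging is a linear condition, so it passes from one basis of L to all of
    the row space. *)
Lemma averagesP (R : realType) (V : finType) (W : {set V}) (a : V -> R)
    (L : 'M[R]_#|V|) :
  averages W a L <-> L *m discrepancy W a = 0.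
Proof.
split=> [[k [B [_ BL H]]]|L0].
  have /submxP[D ->] : (L <= B)%MS by rewrite BL.
  rewrite -mulmxA [B *m _](_ : _ = 0) ?mulmx0 //; apply/matrixP=> r j.
  by rewrite ord1 mulmx_discrepancy H subrr mxE.
exists (\rank L), (row_base L).
split; [exact: row_base_free|exact: eq_row_base|].
move=> r; apply/eqP; rewrite -subr_eq0 -mulmx_discrepancy; apply/eqP.
have /submxP[D ->] : (row_base L <= L)%MS by rewrite eq_row_base.
by rewrite -mulmxA L0 mulmx0 mxE.
Qed.

Definition chi_row (R : realType) d (x : {set 'I_d}) : 'rV[R]_#|hypercube d| :=
  \row_j chi R x (enum_val j).

Definition hypercube_eigenvalue (R : realType) (d k : nat) : R :=
  1 - (2 * k)%N%:R / d%:R.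

Lemma hypercube_eigenvalue_inj (R : realType) (d : nat) :
  (0 < d)%N -> injective (hypercube_eigenvalue R d).
Proof.
move=> d0 k l /addrI/oppr_inj/mulIf.
rewrite invr_eq0 pnatr_eq0 -lt0n => /(_ d0)/eqP.
by rewrite eqr_nat; lia.
Qed.

(** Among the d flips, those of the #|x| coordinates in x change the sign. *)
Lemma sum_chi_flip (R : realType) d (x : {set 'I_d}) (y : hypercube d) :
  \sum_i chi R x (flip i y) = (d%:R - (2 * #|x|)%N%:R) * chi R x y.
Proof.
under eq_bigr do rewrite chi_flip.
rewrite -mulr_suml; congr (_ * _).
rewrite (eq_bigr (fun i => 1 - 2 * (i \in x)%:R)) => [|i _]; last first.
  by case: (i \in x) => /=; ring.
rewrite big_split sumr_const card_ord sumrN -mulr_sumr -natr_sum natrM.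
by rewrite -sum1_card [in RHS]big_mkcond.
Qed.

Lemma chi_row_eigen (R : realType) d (x : {set 'I_d}) : (0 < d)%N ->
  chi_row R x *m hypercube_norm_adjacency R d =
    hypercube_eigenvalue R d #|x| *: chi_row R x.
Proof.
move=> d0; apply/rowP=> j; rewrite -scalemxAr 2!mxE.
rewrite (reindex enum_rank) /=; last first.
  by exists enum_val => i _; rewrite ?enum_rankK ?enum_valK.
under eq_bigr do rewrite !mxE !enum_rankK mulr_natr mulrb.
rewrite -big_mkcond sum_neighbors sum_chi_flip !mxE /hypercube_eigenvalue.
by field; rewrite pnatr_eq0 -lt0n.
Qed.

Lemma norm_adjacency_sym (R : realType) d :
  (hypercube_norm_adjacency R d)^T = hypercube_norm_adjacency R d.
Proof. by apply/matrixP=> i j; rewrite !mxE hypercube_adj_sym. Qed.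

(** The adjacency matrix is symmetric, so eigenvectors with different
    eigenvalues are orthogonal. *)
Lemma eigenspace_chi_orth (R : realType) d (x : {set 'I_d}) (i : 'I_d.+1) :
  (0 < d)%N -> #|x| != i -> hypercube_eigenspace R i *m (chi_row R x)^T = 0.
Proof.
move=> d0 xi; set L := hypercube_eigenspace R i.
set N := hypercube_norm_adjacency R d.
have LN : L *m N = hypercube_eigenvalue R d i *: L by exact/eigenspaceP.
have : L *m N *m (chi_row R x)^T =
    hypercube_eigenvalue R d #|x| *: (L *m (chi_row R x)^T).
  rewrite -mulmxA -[N in LHS]norm_adjacency_sym -trmx_mul chi_row_eigen //.
  by rewrite linearZ /= scalemxAr.
rewrite LN -scalemxAl => /eqP; rewrite -subr_eq0 -scalerBl scaler_eq0 subr_eq0.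
case/orP=> [|/eqP //].
by rewrite (inj_eq (@hypercube_eigenvalue_inj R d d0)) eq_sym (negbTE xi).
Qed.

Lemma ordered_lt_max d (s : 'S_d.+1) (j : 'I_d.+1) :
  s ord_max = 2%N :> nat -> (j < d)%N = (s j != 2%N :> nat).
Proof.
move=> smax; rewrite -smax (inj_eq val_inj) (inj_eq perm_inj) -val_eqE /=.
by rewrite ltn_neqAle -ltnS ltn_ord andbT.
Qed.

(** The function f is 2^d times the weights, extended by 0 outside W.  The
    averaging conditions prescribe its Fourier coefficients outside weight 2. *)
Lemma extremal_design_quadratic (R : realType) d (s : 'S_d.+1)
    (W : {set hypercube d}) :
  (0 < d)%N -> s ord_max = 2%N :> nat ->
  extremal_design (ordered_eigenspaces R s) W ->
  exists (f : hypercube d -> R) (c : {set 'I_d} -> R),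
    (forall y, f y = 1 + \sum_(x : {set 'I_d} | #|x| == 2%N) c x * chi R x y) /\
    (forall y, f y != 0 -> y \in W).
Proof.
move=> d0 smax [a aP].
have ahat (x : {set 'I_d}) : #|x| != 2%N ->
    \sum_(w in W) a w * chi R x w = 2 ^- d * \sum_y chi R x y.
  move=> x2; have xd : (#|x| < d.+1)%N.
    by rewrite ltnS -[X in (_ <= X)%N]card_ord max_card.
  pose j := (s^-1)%g (Ordinal xd); have sj : s j = Ordinal xd by rewrite permKV.
  have jd : (j < d)%N by rewrite (ordered_lt_max _ smax) sj.
  have /averagesP L0 := aP j jd.
  have /submxP[D xD] : (chi_row R x <= ordered_eigenspaces R s j)%MS.
    by apply/eigenspaceP; rewrite chi_row_eigen // sj.
  have := mulmx_discrepancy W a (chi_row R x) 0.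
  rewrite xD -mulmxA L0 mulmx0 mxE -xD.
  under eq_bigr do rewrite mxE enum_rankK.
  under [X in _ - _ * X]eq_bigr do rewrite mxE enum_rankK.
  by rewrite card_hypercube natrX => /esym/eqP; rewrite subr_eq0 => /eqP.
pose f y := 2 ^+ d * (if y \in W then a y else 0).
pose c x := 2 ^- d * \sum_z f z * chi R x z.
have p2 : 2 ^+ d != 0 :> R by rewrite expf_neq0 // pnatr_eq0.
exists f, c; split=> y; last by rewrite /f; case: ifP => //; rewrite mulr0 eqxx.
apply: (mulfI p2); rewrite fourier_inversion mulrDr mulr1 mulr_sumr.
rewrite (bigID (fun x : {set 'I_d} => #|x| == 2%N)) /= addrC.
congr (_ + _); last first.
  by apply: eq_bigr => x _; rewrite /c -mulrA mulVKf.
have fhat (x : {set 'I_d}) :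
    #|x| != 2%N -> \sum_z f z * chi R x z = \sum_z chi R x z.
  move=> /ahat ax; apply: (mulfI (invr_neq0 p2)).
  rewrite -ax mulr_sumr [RHS]big_mkcond; apply: eq_bigr => z _; rewrite /f.
  by case: ifP => _; rewrite ?mulr0 ?mul0r ?mulr0 // -mulrA mulKf.
rewrite (bigD1 set0) ?cards0 //= fhat ?cards0 // chi0 mulr1.
rewrite [X in X + _](eq_bigr (fun=> 1)) => [|z _]; last exact: chi0.
rewrite sumr_const card_hypercube natrX big1 ?addr0 // => x /andP[x2 x0].
by rewrite fhat // sum_chi // mul0r.
Qed.

(** * Triangle designs are the minimum extremal designs *)

Lemma card3P d (T : {set 'I_d}) : #|T| = 3%N ->
  exists i j k, [/\ i != j, i != k, j != k & T = [set i; j; k]].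
Proof.
move=> T3; have [i iT] : exists i, i \in T by apply/card_gt0P; rewrite T3.
have /cards2P[j [k [jk Tjk]]] : #|T :\ i| == 2%N
  by have := cardsD1 i T; rewrite iT T3; lia.
have [ji ki] : j != i /\ k != i.
  have := set21 j k; have := set22 j k.
  by rewrite -Tjk !inE => /andP[-> _] /andP[-> _].
by exists i, j, k; split=> //; rewrite 1?eq_sym // -setUA -Tjk setD1K.
Qed.

(** With signs e_l = (-1)^(y_l + A_l), the right-hand side is
    1 + e_i e_j + e_i e_k + e_j e_k, which is 4 if the three signs are equal and
    0 otherwise. *)
Lemma indicator_triangle (R : realFieldType) d (A : {set 'I_d})
    (i j k : 'I_d) (y : hypercube d) :
  i != j -> i != k -> j != k ->
  4 * (y \in triangle_design [set i; j; k] A)%:R =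
    1 + (-1) ^+ (i \in A) * (-1) ^+ (j \in A) * chi R [set i; j] y
      + (-1) ^+ (i \in A) * (-1) ^+ (k \in A) * chi R [set i; k] y
      + (-1) ^+ (j \in A) * (-1) ^+ (k \in A) * chi R [set j; k] y.
Proof.
move=> ij ik jk; rewrite !chi2 //.
have -> : (y \in triangle_design [set i; j; k] A) =
    (y i (+) (i \in A) == y j (+) (j \in A)) &&
    (y i (+) (i \in A) == y k (+) (k \in A)).
  rewrite inE; apply/existsP/andP => [[b /forall_inP H]|[yj yk]].
    have := H i; have := H j; have := H k; rewrite !inE !eqxx !orbT.
    move=> /(_ isT)/eqP -> /(_ isT)/eqP -> /(_ isT)/eqP ->.
    by case: b {H}; case: (i \in A); case: (j \in A); case: (k \in A).
  exists (y i (+) (i \in A)); apply/forall_inP=> l.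
  rewrite !inE => /orP[/orP[]|] /eqP ->.
  - by rewrite addbC -addbA addbb addbF.
  - by rewrite (eqP yj) addbC -addbA addbb addbF.
  - by rewrite (eqP yk) addbC -addbA addbb addbF.
case: (y i); case: (y j); case: (y k); case: (i \in A); case: (j \in A);
  by case: (k \in A) => /=; ring.
Qed.

(** Only the constant term of the expansion of the indicator function survives
    the sum over the cube. *)
Lemma card_triangle_design d (T A : {set 'I_d}) :
  #|T| = 3%N -> (4 * #|triangle_design T A| = 2 ^ d)%N.
Proof.
case/card3P=> i [j [k [ij ik jk ->]]]; apply/eqP; rewrite -(eqr_nat rat) natrM.
rewrite -sum1_card natr_sum big_mkcond mulr_sumr /=.
rewrite (eq_bigr (fun y =>
    4 * (y \in triangle_design [set i; j; k] A)%:R)) => [|y _];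
  last by case: ifP.
under eq_bigr do rewrite indicator_triangle //.
rewrite !big_split /= -!mulr_sumr !sum_chi -?card_gt0 ?cards2 ?ij ?ik ?jk //.
by rewrite !mulr0 !addr0 sumr_const card_hypercube.
Qed.

(** Constant weights work: by the previous expansion the discrepancy is then a
    combination of characters of weight 2. *)
Lemma triangle_design_extremal (R : realType) d (s : 'S_d.+1)
    (T A : {set 'I_d}) :
  (0 < d)%N -> s ord_max = 2%N :> nat -> #|T| = 3%N ->
  extremal_design (ordered_eigenspaces R s) (triangle_design T A).
Proof.
move=> d0 smax /card3P[i [j [k [ij ik jk ->]]]].
exists (fun=> 4 / 2 ^+ d) => l ld; apply/averagesP.
have -> : discrepancy (triangle_design [set i; j; k] A) (fun=> 4 / 2 ^+ d) =
  2 ^- d *: (((-1) ^+ (i \in A) * (-1) ^+ (j \in A)) *: (chi_row R [set i; j])^T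
   + ((-1) ^+ (i \in A) * (-1) ^+ (k \in A)) *: (chi_row R [set i; k])^T
   + ((-1) ^+ (j \in A) * (-1) ^+ (k \in A)) *: (chi_row R [set j; k])^T).
  apply/colP=> m; rewrite !mxE card_hypercube natrX.
  transitivity (2 ^- d *
    (4 * (enum_val m \in triangle_design [set i; j; k] A)%:R - 1) : R).
    by case: ifP => _ /=; ring.
  rewrite indicator_triangle //. ring.
have L2 : s l != 2%N :> nat by rewrite -(ordered_lt_max _ smax).
rewrite -scalemxAr !mulmxDr -!scalemxAr !eigenspace_chi_orth //;
  by rewrite ?scaler0 ?addr0 ?scaler0 // cards2 ?ij ?ik ?jk eq_sym.
Qed.

(** Triangle designs exist since d >= 3, so a minimum design satisfies
    4 |W| <= 2^d, and the analysis of small supports applies; no design can do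
    better, as the same analysis turns 4 |W| <= 2^d into an equality. *)
Lemma min_extremal_designP (R : realType) d (s : 'S_d.+1)
    (W : {set hypercube d}) :
  (3 <= d)%N -> s ord_max = 2%N :> nat ->
  min_extremal_design (ordered_eigenspaces R s) W <->
  exists2 p, p \in triangle_index d & W = triangle_design p.1 p.2.
Proof.
move=> d3 smax; have d0 : (0 < d)%N by apply: leq_trans d3.
split=> [[Wext Wmin]|[[T A]]].
  have [T0 T03] : exists T0 : {set 'I_d}, #|T0| = 3%N.
    have : (0 < #|[set T : {set 'I_d} | #|T| == 3%N]|)%N.
      by rewrite card_draws card_ord bin_gt0.
    by case/card_gt0P=> T0; rewrite inE => /eqP; exists T0.
  have [f [c [fE fW]]] := extremal_design_quadratic d0 smax Wext.
  have W4 : (4 * #|W| <= 2 ^ d)%N.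
    rewrite -(card_triangle_design set0 T03) leq_mul2l.
    exact/Wmin/triangle_design_extremal.
  have [T [A [T3 AT A1 ->]]] := quadratic_support_triangle fE fW W4.
  by exists (T, A); rewrite // inE T3 eqxx AT.
rewrite inE /= => /and3P[/eqP T3 AT A1] ->.
split; first exact: triangle_design_extremal.
move=> W' /(extremal_design_quadratic d0 smax)[f [c [fE fW]]].
rewrite -(leq_pmul2l (m := 4)) // (card_triangle_design A T3) leqNgt.
apply/negP => W'4.
by have := card_quadratic_support fE fW (ltnW W'4); lia.
Qed.

Theorem theorem5p5 (R : realType) (d : nat) (s : 'S_d.+1)
    (d_ge3 : (3 <= d)%N)
    (Lambda0_first : s ord0 = 0%N :> nat)
    (Lambda2_last : s ord_max = 2%N :> nat) :
  #|min_extremal_designs (ordered_eigenspaces R s)| = (4 * 'C(d, 3))%N /\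
  forall W : {set hypercube d},
    W \in min_extremal_designs (ordered_eigenspaces R s) ->
    #|W| = (2 ^ (d - 2))%N.
Proof.
have minE W : W \in min_extremal_designs (ordered_eigenspaces R s) <->
    exists2 p, p \in triangle_index d & W = triangle_design p.1 p.2.
  have P := @min_extremal_designP R d s W d_ge3 Lambda2_last.
  by rewrite inE; split=> [/asboolP/P|/P H] //; exact/asboolP.
split=> [|W /minE[[T A]]].
  rewrite -card_triangle_index.
  have -> : min_extremal_designs (ordered_eigenspaces R s) =
      [set triangle_design p.1 p.2 | p in triangle_index d].
    by apply/setP=> W; apply/idP/imsetP => /minE.
  apply: card_in_imset => -[T A] [T' A']; rewrite !inE /=.
  move=> /and3P[/eqP T3 AT A1] /and3P[/eqP T'3 A'T' A'1].
  exact: triangle_design_inj.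
rewrite inE /= => /and3P[/eqP T3 AT A1] ->.
apply/eqP; rewrite -(eqn_pmul2l (m := 4)) // card_triangle_design //.
by rewrite -(expnD 2 2) subnKC // ltnW.
Qed.
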